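(* Let $p\ge 1$ and $n>p+2$ be integers, let $\mathbb{F}$ be a field of characteristic zero, and let $\mathcal{A}$ be an $n$-dimensional associative $\mathbb{F}$-algebra which is naturally graded and filiform of degree $p$. Then $\mathcal{A}$ is isomorphic to the direct sum of algebras $\mu_0^{n-p}\oplus\mathbb{F}^p$.
   Context: Associative algebras are not assumed to be unital. For an algebra $\mathcal{A}$ put $\mathcal{A}^1=\mathcal{A}$ and $\mathcal{A}^{i+1}=\sum_{k=1}^{i}\mathcal{A}^k\mathcal{A}^{i+1-k}$ for $i\ge 1$ (linear spans of products); $\mathcal{A}$ is nilpotent if $\mathcal{A}^i=0$ for some $i$. An $n$-dimensional associative algebra $\mathcal{A}$ is called filiform of degree $p$ if $\dim(\mathcal{A}^i)=n-p+1-i$ for $2\le i\le n-p+1$. For a nilpotent associative algebra $\mathcal{A}$ put $\mathcal{A}_i=\mathcal{A}^i/\mathcal{A}^{i+1}$ and $\operatorname{gr}\mathcal{A}=\bigoplus_{i\ge 1}\mathcal{A}_i$, a graded algebra with the induced product $\mathcal{A}_i\mathcal{A}_j\subseteq\mathcal{A}_{i+j}$. $\mathcal{A}$ is called naturally graded if $\operatorname{gr}\mathcal{A}\cong\mathcal{A}$ as algebras. For $m\ge 1$, $\mu_0^m$ denotes the $m$-dimensional algebra with basis $e_1,\dots,e_m$ and products $e_ie_j=e_{i+j}$ for $i,j\ge 1$, $2\le i+j\le m$, all other products of basis elements being zero. $\mathbb{F}^p$ denotes the $p$-dimensional algebra with zero multiplication. *)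

(* Defs.v *)
From HB Require Import structures.
From mathcomp Require Import all_boot all_order all_algebra.

Set Implicit Arguments.
Unset Strict Implicit.
Unset Printing Implicit Defensive.

Import GRing.Theory.
Local Open Scope ring_scope.
Local Open Scope quotient_scope.

Reserved Notation "x ** y" (at level 40, left associativity).

(* MathComp's algebra structures (lalgType, algType, falgType) are all unital. *)
HB.mixin Record Lmodule_isNuAlg (F : fieldType) A of GRing.Lmodule F A := {
  numul : A -> A -> A;
  numulA : associative numul;
  numulDl : left_distributive numul +%R;
  numulDr : right_distributive numul +%R;
  numulZl : forall (a : F) (x y : A), numul (a *: x) y = a *: numul x y;
  numulZr : forall (a : F) (x y : A), numul x (a *: y) = a *: numul x y
}.

#[short(type="nuAlgType")]
HB.structure Definition NuAlg (F : fieldType) :=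
  { A of GRing.Lmodule F A & Lmodule_isNuAlg F A }.

#[short(type="nuVectAlgType")]
HB.structure Definition NuVectAlg (F : fieldType) :=
  { A of Vector F A & NuAlg F A }.

Notation "x ** y" := (numul x y) : ring_scope.

Definition nualg_isomorphic (F : fieldType) (A B : nuAlgType F) : Prop :=
  exists f : {linear A -> B}, bijective f /\ {morph f : x y / x ** y}.

Section NuAlgTheory.

Variables (F : fieldType) (A : nuAlgType F).
Implicit Types x y z : A.

Lemma numul0l y : 0 ** y = 0.
Proof. by have := numulZl 0 0 y; rewrite !scale0r. Qed.

Lemma numul0r x : x ** 0 = 0.
Proof. by have := numulZr 0 x 0; rewrite !scale0r. Qed.

Lemma numul_suml I r (P : pred I) (f : I -> A) y :
  (\sum_(i <- r | P i) f i) ** y = \sum_(i <- r | P i) f i ** y.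
Proof.
by apply: (big_morph (numul^~ y)) => [x z|]; rewrite ?numulDl ?numul0l.
Qed.

Lemma numul_sumr I r (P : pred I) (f : I -> A) x :
  x ** (\sum_(i <- r | P i) f i) = \sum_(i <- r | P i) x ** f i.
Proof.
by apply: (big_morph (numul x)) => [y z|]; rewrite ?numulDr ?numul0r.
Qed.

Lemma numulBl x y z : (x - y) ** z = x ** z - y ** z.
Proof. by rewrite numulDl -[- y]scaleN1r numulZl scaleN1r. Qed.

Lemma numulBr x y z : x ** (y - z) = x ** y - x ** z.
Proof. by rewrite numulDr -[- z]scaleN1r numulZr scaleN1r. Qed.

End NuAlgTheory.

Section NuProdv.

Variables (F : fieldType) (A : nuVectAlgType F).
Implicit Types U V W : {vspace A}.

Definition nuprodv U V : {vspace A} :=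
  <<[seq u ** v | u <- vbasis U, v <- vbasis V]>>%VS.

Lemma memv_numul U V : {in U & V, forall u v, u ** v \in nuprodv U V}.
Proof.
move=> u v /coord_vbasis-> /coord_vbasis->.
rewrite numul_suml; apply: memv_suml => i _.
rewrite numul_sumr; apply: memv_suml => j _.
rewrite numulZl numulZr !memvZ // memv_span //.
by apply/allpairsP; exists ((vbasis U)`_i, (vbasis V)`_j); rewrite !memt_nth.
Qed.

Lemma nuprodvP {U V W} :
  reflect {in U & V, forall u v, u ** v \in W} (nuprodv U V <= W)%VS.
Proof.
apply: (iffP idP) => [sUVW u v Uu Vv | sUVW].
  by rewrite (subvP sUVW) ?memv_numul.
apply/span_subvP=> _ /allpairsP[[u v] /= [Uu Vv ->]].
by rewrite sUVW ?vbasis_mem.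
Qed.

Lemma memv_nuprodv_numul U V W x w :
  x \in nuprodv U V -> (forall u v, u \in U -> v \in V -> u ** (v ** w) \in W) ->
  x ** w \in W.
Proof.
rewrite /nuprodv; set s := [seq _ | _ <- _, _ <- _] => xs sW.
rewrite (coord_span (X := in_tuple s) xs).
rewrite numul_suml; apply: memv_suml => i _; rewrite numulZl memvZ //.
have /allpairsP[[u v] /= [Uu Vv ->]] := mem_nth 0 (ltn_ord i).
by rewrite -numulA sW ?vbasis_mem.
Qed.

Lemma nuprodvS U1 U2 V1 V2 :
  (U1 <= U2 -> V1 <= V2 -> nuprodv U1 V1 <= nuprodv U2 V2)%VS.
Proof.
move/subvP=> sU12 /subvP sV12; apply/nuprodvP=> u v Uu Vv.
by rewrite memv_numul ?sU12 ?sV12.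
Qed.

End NuProdv.

Section Powers.

Variables (F : fieldType) (A : nuVectAlgType F).

(* nupows n = [:: A^1; ...; A^n.+1] *)
Fixpoint nupows (n : nat) : seq {vspace A} :=
  if n is n'.+1 then
    let s := nupows n' in
    rcons s (\sum_(k < n) nuprodv (nth fullv s k) (nth fullv s (n' - k)))%VS
  else [:: fullv].

(* A^i for i >= 1, and by convention A^0 = A; see nupow1 and nupowS *)
Definition nupow (i : nat) : {vspace A} := nth fullv (nupows i.-1) i.-1.

Lemma size_nupows n : size (nupows n) = n.+1.
Proof. by elim: n => //= n IHn; rewrite size_rcons IHn. Qed.

Lemma nth_nupows n k : (k <= n)%N -> nth fullv (nupows n) k = nupow k.+1.
Proof.
rewrite /nupow /=; elim: n => [|n IHn]; first by case: k.
rewrite leq_eqVlt => /predU1P[-> //|]; rewrite ltnS => le_kn.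
by rewrite [nupows n.+1]/= nth_rcons size_nupows ltnS le_kn IHn.
Qed.

Lemma nupow1 : nupow 1 = fullv.
Proof. by []. Qed.

Lemma nupowS i : (1 <= i)%N ->
  nupow i.+1 = (\sum_(1 <= k < i.+1) nuprodv (nupow k) (nupow (i.+1 - k)))%VS.
Proof.
case: i => // i _; rewrite {1}/nupow [nupows _.+1.-1]/= nth_rcons size_nupows.
rewrite ltnn eqxx big_add1 big_mkord; apply: eq_bigr => k _.
by rewrite !nth_nupows ?leq_subr ?leq_ord // subSS subSn ?leq_ord.
Qed.

Definition nilpotent_alg : Prop := exists2 i, (1 <= i)%N & nupow i = 0%VS.

Definition filiform (p : nat) : Prop :=
  forall i, (2 <= i <= \dim {:A} - p + 1)%N ->
    \dim (nupow i) = (\dim {:A} - p + 1 - i)%N.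

Lemma nupow_mul i j u v : (1 <= i)%N -> (1 <= j)%N ->
  u \in nupow i -> v \in nupow j -> u ** v \in nupow (i + j).
Proof.
move=> i_gt0 j_gt0 Uu Vv; case: j j_gt0 Vv => // j _ Vv.
rewrite addnS nupowS ?addn_gt0 ?i_gt0 // (bigD1_seq i) /= ?iota_uniq //; last first.
  by rewrite mem_index_iota i_gt0 ltnS leq_addr.
apply: (subvP (addvSl _ _)).
by rewrite -addnS addKn memv_numul.
Qed.

Lemma nupowS_subv i (W : {vspace A}) : (1 <= i)%N ->
  (forall k u v, (1 <= k <= i)%N -> u \in nupow k -> v \in nupow (i.+1 - k) ->
     u ** v \in W) -> (nupow i.+1 <= W)%VS.
Proof.
move=> i_gt0 sW; rewrite nupowS // big_seq.
apply: (big_ind (fun U => (U <= W)%VS)) => [|U V sU sV|k].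
- exact: sub0v.
- by rewrite subv_add sU.
- rewrite mem_index_iota ltnS => ki; apply/nuprodvP=> u v; exact: sW.
Qed.

Lemma nupow_anti i : (nupow i.+1 <= nupow i)%VS.
Proof.
elim/ltn_ind: i => -[|[|i]] IHi; rewrite ?subvf //.
apply: nupowS_subv => // k u v /andP[k_gt0].
rewrite leq_eqVlt => /predU1P[->|lt_ki] Uu.
  rewrite subSnn => Vv; rewrite -[i.+2]addn1 nupow_mul //.
  exact: (subvP (IHi i.+1 _)) Uu.
rewrite subSn 1?ltnW // => Vv.
rewrite -(subnKC (ltnW lt_ki)) nupow_mul ?subn_gt0 //.
by apply: (subvP (IHi _ _)) Vv; rewrite ltn_subrL k_gt0.
Qed.

Lemma nupowSl i : (1 <= i)%N -> nupow i.+1 = nuprodv fullv (nupow i).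
Proof.
elim/ltn_ind: i => i IHi i_gt0; apply: subv_anti; apply/andP; split; last first.
  by apply/nuprodvP => u v Uu Vv; rewrite -add1n nupow_mul.
apply: nupowS_subv => // -[//|[|k]] u v /= le_ki Uu.
  by rewrite subn1 => Vv; rewrite memv_numul.
rewrite subSS => Vv; rewrite IHi // in Uu.
apply: memv_nuprodv_numul Uu _ => x y Ux Uy; rewrite memv_numul //.
by rewrite -(subnKC (ltnW le_ki)) nupow_mul ?subn_gt0.
Qed.

Lemma nupow_eq0 i : nilpotent_alg -> (\dim {:A} < i)%N -> nupow i = 0%VS.
Proof.
case=> N N_gt0 N0.
have stable j : (1 <= j)%N -> nupow j.+1 = nupow j -> nupow j = 0%VS.
  move=> j_gt0 eqj.
  have const k : nupow (j + k) = nupow j.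
    elim: k => [|k IHk]; first by rewrite addn0.
    by rewrite addnS nupowSl ?addn_gt0 ?j_gt0 // IHk -nupowSl.
  have anti m k : (nupow (m + k) <= nupow m)%VS.
    elim: k => [|k IHk]; first by rewrite addn0.
    by rewrite addnS (subv_trans (nupow_anti _)).
  by apply/eqP; rewrite -subv0 -N0 -(const N) addnC anti.
have bound j : nupow j.+1 = 0%VS \/ (\dim (nupow j.+1) + j <= \dim {:A})%N.
  elim: j => [|j [IHj|IHj]]; first by right; rewrite addn0.
    by left; apply/eqP; rewrite -subv0 -IHj nupow_anti.
  have [/eqP eqj|neqj] := boolP (nupow j.+2 == nupow j.+1).
    by left; rewrite eqj; apply: stable.
  right; rewrite addnS (leq_trans _ IHj) // -addSn leq_add2r.
  by rewrite ltnNge; apply: contra neqj => le; rewrite eqEdim nupow_anti.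
case: i => [//|i]; rewrite ltnS => le_i.
case: (bound i) => // le_dim; apply/eqP; rewrite -dimv_eq0 -leqn0.
by rewrite -(leq_add2r i) (leq_trans le_dim).
Qed.

End Powers.

Section HomogeneousComponents.

Variables (F : fieldType) (A : nuVectAlgType F).

Definition nextpow (i : nat) : {pred subvs_of (nupow A i)} :=
  fun u => vsval u \in nupow A i.+1.
Local Arguments nextpow : clear implicits.

Fact nextpow_submod i : submod_closed (nextpow i).
Proof.
have E u : (u \in nextpow i) = (vsval u \in nupow A i.+1) by [].
split=> [|a u v]; rewrite !E ?linear0 ?mem0v // linearP /= => Uu Vv.
by rewrite memvD ?memvZ.
Qed.
HB.instance Definition _ i :=
  GRing.isSubmodClosed.Build F _ (nextpow i) (nextpow_submod i).

(* A_i = A^i / A^(i+1) *)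
Definition grcomp (i : nat) := Quotient.quot (nextpow i).
HB.instance Definition _ i := GRing.Zmodule.on (grcomp i).

Definition grcls (i : nat) (x : A) : grcomp i :=
  \pi_(Quotient.quot (nextpow i)) (vsproj (nupow A i) x).

Definition grrep (i : nat) (X : grcomp i) : A := vsval (repr (X : Quotient.quot (nextpow i))).

Lemma grrep_mem i (X : grcomp i) : grrep X \in nupow A i.
Proof. exact: subvsP. Qed.

Lemma grrepK i : cancel (@grrep i) (@grcls i).
Proof. by move=> X; rewrite /grcls /grrep vsvalK reprK. Qed.

Lemma grcls_eq i x y : x \in nupow A i -> y \in nupow A i ->
  reflect (grcls i x = grcls i y) (x - y \in nupow A i.+1).
Proof.
move=> Ux Uy; set U := nupow A i.
have -> : (x - y \in nupow A i.+1) = (vsproj U x - vsproj U y \in nextpow i).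
  by rewrite -[RHS]/(vsval _ \in _) linearB /= !vsprojK.
by rewrite Quotient.idealrBE; apply: eqP.
Qed.

Lemma grrep_cls i x : x \in nupow A i -> grrep (grcls i x) - x \in nupow A i.+1.
Proof. by move=> Ux; apply/grcls_eq; rewrite ?grrep_mem ?grrepK. Qed.

Definition grscale (i : nat) (a : F) (X : grcomp i) : grcomp i :=
  grcls i (a *: grrep X).

Fact grcls_is_zmod_morphism i : zmod_morphism (grcls i).
Proof. by move=> x y; rewrite /grcls linearB raddfB. Qed.
HB.instance Definition _ i :=
  GRing.isZmodMorphism.Build A (grcomp i) (grcls i) (grcls_is_zmod_morphism i).

Lemma grcls_scale i a x : x \in nupow A i -> grscale a (grcls i x) = grcls i (a *: x).
Proof.
move=> Ux; apply/grcls_eq; rewrite ?memvZ ?grrep_mem //.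
by rewrite -scalerBr memvZ ?grrep_cls.
Qed.

Fact grscaleA i a b (X : grcomp i) : grscale a (grscale b X) = grscale (a * b) X.
Proof. by rewrite grcls_scale ?memvZ ?grrep_mem // scalerA. Qed.
Fact grscale1 i : left_id 1 (@grscale i).
Proof. by move=> X; rewrite /grscale scale1r grrepK. Qed.
Fact grscaleDr i : right_distributive (@grscale i) +%R.
Proof.
move=> a X Y; rewrite -[X]grrepK -[Y]grrepK -raddfD.
by rewrite !grcls_scale ?memvD ?grrep_mem // scalerDr raddfD.
Qed.
Fact grscaleDl i (X : grcomp i) : {morph (@grscale i)^~ X : a b / a + b}.
Proof. by move=> a b; rewrite /grscale scalerDl raddfD. Qed.

HB.instance Definition _ i := GRing.Zmodule_isLmodule.Build F (grcomp i)
  (@grscaleA i) (@grscale1 i) (@grscaleDr i) (@grscaleDl i).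

Lemma grclsZ i a x : x \in nupow A i -> grcls i (a *: x) = a *: grcls i x.
Proof. by move=> Ux; rewrite -grcls_scale. Qed.

(* The product A_i x A_j -> A_k, meaningful only for k = i + j; a separate index
   k avoids transporting along equations between degrees. *)
Definition grmul (i j k : nat) (X : grcomp i) (Y : grcomp j) : grcomp k :=
  grcls k (grrep X ** grrep Y).

Section Product.

Variables (i j k : nat).
Hypotheses (i_gt0 : (1 <= i)%N) (j_gt0 : (1 <= j)%N) (kE : k = (i + j)%N).
Implicit Types (X : grcomp i) (Y : grcomp j).

Lemma grmul_cls x y : x \in nupow A i -> y \in nupow A j ->
  grmul k (grcls i x) (grcls j y) = grcls k (x ** y).
Proof.
move=> Ux Uy; apply/grcls_eq; rewrite ?kE ?nupow_mul ?grrep_mem //.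
set x' := grrep _; set y' := grrep _.
have -> : x' ** y' - x ** y = (x' - x) ** y' + x ** (y' - y).
  by rewrite numulBl numulBr addrA subrK.
rewrite memvD //; [rewrite -addSn | rewrite -addnS].
  by rewrite nupow_mul ?grrep_cls ?grrep_mem.
by rewrite nupow_mul ?grrep_cls.
Qed.

Lemma grmulDl X X' Y : grmul k (X + X') Y = grmul k X Y + grmul k X' Y.
Proof.
rewrite -[X]grrepK -[X']grrepK -[Y]grrepK -raddfD.
by rewrite !grmul_cls ?memvD ?grrep_mem // numulDl raddfD.
Qed.

Lemma grmulDr X Y Y' : grmul k X (Y + Y') = grmul k X Y + grmul k X Y'.
Proof.
rewrite -[X]grrepK -[Y]grrepK -[Y']grrepK -raddfD.
by rewrite !grmul_cls ?memvD ?grrep_mem // numulDr raddfD.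
Qed.

Lemma grmulZl a X Y : grmul k (a *: X) Y = a *: grmul k X Y.
Proof.
rewrite -[X]grrepK -[Y]grrepK -grclsZ ?grrep_mem //.
rewrite !grmul_cls ?memvZ ?grrep_mem // numulZl grclsZ //.
by rewrite kE nupow_mul ?grrep_mem.
Qed.

Lemma grmulZr a X Y : grmul k X (a *: Y) = a *: grmul k X Y.
Proof.
rewrite -[X]grrepK -[Y]grrepK -grclsZ ?grrep_mem //.
rewrite !grmul_cls ?memvZ ?grrep_mem // numulZr grclsZ //.
by rewrite kE nupow_mul ?grrep_mem.
Qed.

Lemma grmul0l Y : grmul k (0 : grcomp i) Y = 0.
Proof. by have := grmulZl 0 0 Y; rewrite !scale0r. Qed.

Lemma grmul0r X : grmul k X (0 : grcomp j) = 0.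
Proof. by have := grmulZr 0 X 0; rewrite !scale0r. Qed.

Lemma grmul_suml I r (P : pred I) (f : I -> grcomp i) Y :
  grmul k (\sum_(l <- r | P l) f l) Y = \sum_(l <- r | P l) grmul k (f l) Y.
Proof.
apply: (big_morph (fun X : grcomp i => grmul k X Y)) => [X X'|]; first exact: grmulDl.
exact: grmul0l.
Qed.

Lemma grmul_sumr I r (P : pred I) (f : I -> grcomp j) X :
  grmul k X (\sum_(l <- r | P l) f l) = \sum_(l <- r | P l) grmul k X (f l).
Proof.
apply: (big_morph (grmul k X)) => [Y Y'|]; first exact: grmulDr.
exact: grmul0r.
Qed.

End Product.

Lemma grmulA i j k ij jk l (X : grcomp i) (Y : grcomp j) (Z : grcomp k) :
  (1 <= i)%N -> (1 <= j)%N -> (1 <= k)%N ->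
  ij = (i + j)%N -> jk = (j + k)%N -> l = (i + j + k)%N ->
  grmul l X (grmul jk Y Z) = grmul l (grmul ij X Y) Z.
Proof.
move=> i_gt0 j_gt0 k_gt0 ijE jkE lE; rewrite -[X]grrepK -[Y]grrepK -[Z]grrepK.
have ? := @grrep_mem i X; have ? := @grrep_mem j Y; have ? := @grrep_mem k Z.
by rewrite !grmul_cls ?numulA ?ijE ?jkE ?nupow_mul ?addn_gt0 ?i_gt0 ?j_gt0 //
  lE ?addnA.
Qed.

End HomogeneousComponents.

Section AssociatedGraded.

Variables (F : fieldType) (A : nuVectAlgType F).

(* The direct sum of the A_d over 1 <= d <= dim A, the i-th component being in
   degree d = i.+1. For nilpotent A this is the sum over all d >= 1, since the
   other A_d vanish by nupow_eq0. *)
Definition gr := {dffun forall i : 'I_(\dim {:A}), grcomp A i.+1}.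
HB.instance Definition _ := Choice.on gr.

Implicit Types x y z : gr.

Definition gr_zero : gr := [ffun i => 0].
Definition gr_opp x : gr := [ffun i => - x i].
Definition gr_add x y : gr := [ffun i => x i + y i].
Definition gr_scale (a : F) x : gr := [ffun i => a *: x i].
Definition gr_mul x y : gr :=
  [ffun k : 'I_(\dim {:A}) =>
     \sum_(i < \dim {:A}) \sum_(j < \dim {:A} | (i.+1 + j.+1 == k.+1)%N)
        grmul k.+1 (x i) (y j)].

Fact gr_addA : associative gr_add.
Proof. by move=> x y z; apply/ffunP => i; rewrite !ffunE addrA. Qed.
Fact gr_addC : commutative gr_add.
Proof. by move=> x y; apply/ffunP => i; rewrite !ffunE addrC. Qed.
Fact gr_add0 : left_id gr_zero gr_add.
Proof. by move=> x; apply/ffunP => i; rewrite !ffunE add0r. Qed.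
Fact gr_addN : left_inverse gr_zero gr_opp gr_add.
Proof. by move=> x; apply/ffunP => i; rewrite !ffunE addNr. Qed.

HB.instance Definition _ :=
  GRing.isZmodule.Build gr gr_addA gr_addC gr_add0 gr_addN.

Fact gr_scaleA a b x : gr_scale a (gr_scale b x) = gr_scale (a * b) x.
Proof. by apply/ffunP => i; rewrite !ffunE scalerA. Qed.
Fact gr_scale1 : left_id 1 gr_scale.
Proof. by move=> x; apply/ffunP => i; rewrite !ffunE scale1r. Qed.
Fact gr_scaleDr : right_distributive gr_scale +%R.
Proof. by move=> a x y; apply/ffunP => i; rewrite !ffunE scalerDr. Qed.
Fact gr_scaleDl x : {morph gr_scale^~ x : a b / a + b}.
Proof. by move=> a b; apply/ffunP => i; rewrite !ffunE scalerDl. Qed.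

HB.instance Definition _ := GRing.Zmodule_isLmodule.Build F gr
  gr_scaleA gr_scale1 gr_scaleDr gr_scaleDl.

Fact gr_mulDl : left_distributive gr_mul +%R.
Proof.
move=> x y z; apply/ffunP => k; rewrite !ffunE -big_split; apply: eq_bigr => i _.
rewrite -big_split; apply: eq_bigr => j /eqP kE.
by rewrite ffunE grmulDl.
Qed.
Fact gr_mulDr : right_distributive gr_mul +%R.
Proof.
move=> x y z; apply/ffunP => k; rewrite !ffunE -big_split; apply: eq_bigr => i _.
rewrite -big_split; apply: eq_bigr => j /eqP kE.
by rewrite ffunE grmulDr.
Qed.
Fact gr_mulZl a x y : gr_mul (a *: x) y = a *: gr_mul x y.
Proof.
apply/ffunP => k; rewrite !ffunE scaler_sumr; apply: eq_bigr => i _.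
rewrite scaler_sumr; apply: eq_bigr => j /eqP kE.
by rewrite ffunE grmulZl.
Qed.
Fact gr_mulZr a x y : gr_mul x (a *: y) = a *: gr_mul x y.
Proof.
apply/ffunP => k; rewrite !ffunE scaler_sumr; apply: eq_bigr => i _.
rewrite scaler_sumr; apply: eq_bigr => j /eqP kE.
by rewrite ffunE grmulZr.
Qed.

Fact gr_mulA : associative gr_mul.
Proof.
move=> x y z; apply/ffunP => l; rewrite !ffunE.
pose T (i j k : 'I_(\dim {:A})) := grmul l.+1 (x i) (grmul (j.+1 + k.+1) (y j) (z k)).
pose n := \dim {:A}.
transitivity
  (\sum_(i < n) \sum_(j < n) \sum_(k < n | (i.+1 + j.+1 + k.+1 == l.+1)%N) T i j k).
  apply: eq_bigr => i _.
  under eq_bigr => m /eqP mE.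
    rewrite ffunE grmul_sumr //.
    under eq_bigr => j _ do rewrite grmul_sumr //.
    over.
  rewrite exchange_big; apply: eq_bigr => j _ /=.
  rewrite (exchange_big_dep xpredT) //= [RHS]big_mkcond; apply: eq_bigr => k _.
  case: ifP => [/eqP lE|nlE]; last first.
    by rewrite big1 // => m /andP[/eqP mE /eqP jk]; rewrite -addnA jk mE eqxx in nlE.
  have m_lt : (j.+1 + k < \dim {:A})%N.
    by apply: leq_ltn_trans (ltn_ord l); rewrite -ltnS -lE -addnA -addnS leq_addl.
  rewrite (big_pred1 (Ordinal m_lt)) => [|m].
    by rewrite /T /= -addnS.
  rewrite /=; apply/andP/eqP => [[_ /eqP jk]|->].
    by apply: val_inj; move: jk; rewrite addnS => -[].
  by rewrite /= -lE -[(j.+1 + k).+1]addnS addnA !eqxx.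
symmetry; transitivity
  (\sum_(m < n) \sum_(i < n) \sum_(j < n | (i.+1 + j.+1 == m.+1)%N)
    \sum_(k < n | (m.+1 + k.+1 == l.+1)%N)
      grmul l.+1 (grmul m.+1 (x i) (y j)) (z k)).
  apply: eq_bigr => m _.
  under eq_bigr => k /eqP kE.
    rewrite ffunE grmul_suml //.
    under eq_bigr => i _ do rewrite grmul_suml //.
    over.
  by rewrite exchange_big; apply: eq_bigr => i _; rewrite exchange_big.
rewrite exchange_big; apply: eq_bigr => i _.
rewrite (exchange_big_dep xpredT) //=; apply: eq_bigr => j _.
rewrite (exchange_big_dep xpredT) //= [RHS]big_mkcond; apply: eq_bigr => k _.
case: ifP => [/eqP lE|nlE]; last first.
  by rewrite big1 // => m /andP[/eqP ij /eqP mE]; rewrite ij mE eqxx in nlE.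
have m_lt : (i.+1 + j < \dim {:A})%N.
  apply: leq_ltn_trans (ltn_ord l); rewrite -ltnS -lE -addnS.
  exact: leq_addr.
rewrite (big_pred1 (Ordinal m_lt)) => [|m].
  by rewrite /T; symmetry; apply: grmulA; rewrite //= addnS.
rewrite /=; apply/andP/eqP => [[/eqP ij _]|->].
  by apply: val_inj; move: ij; rewrite addnS => -[].
by rewrite /= -lE !addnS !eqxx.
Qed.

HB.instance Definition _ := Lmodule_isNuAlg.Build F gr
  gr_mulA gr_mulDl gr_mulDr gr_mulZl gr_mulZr.

Definition naturally_graded : Prop :=
  nilpotent_alg A /\ nualg_isomorphic gr A.

End AssociatedGraded.

Section Models.

Variable F : fieldType.

Section TruncatedPolynomial.

Variable m : nat.

Definition mu0 : Type := 'rV[F]_m.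
HB.instance Definition _ := Vector.on mu0.

(* e_k for 1 <= k <= m, and 0 for all other k; this e_k is the row vector with
   its 1 at the ordinal k.-1. *)
Definition mu0_e (k : nat) : mu0 := \row_(i < m) (i.+1 == k)%:R.

Definition mu0_mul (x y : mu0) : mu0 :=
  \sum_(i < m) \sum_(j < m)
    ((x : 'rV_m) 0 i * (y : 'rV_m) 0 j) *: mu0_e (i.+1 + j.+1).

Lemma mu0_sum_e (x : mu0) : x = \sum_(i < m) (x : 'rV_m) 0 i *: mu0_e i.+1.
Proof.
apply/rowP => k; rewrite summxE (bigD1 k) //= big1 => [|i ik].
  by rewrite !mxE eqxx mulr1 addr0.
by rewrite !mxE eqSS eq_sym val_eqE (negbTE ik) mulr0.
Qed.

Fact mu0_mulDl : left_distributive mu0_mul +%R.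
Proof.
move=> x y z; rewrite /mu0_mul -big_split; apply: eq_bigr => i _.
rewrite -big_split; apply: eq_bigr => j _.
by rewrite mxE mulrDl scalerDl.
Qed.
Fact mu0_mulDr : right_distributive mu0_mul +%R.
Proof.
move=> x y z; rewrite /mu0_mul -big_split; apply: eq_bigr => i _.
rewrite -big_split; apply: eq_bigr => j _.
by rewrite mxE mulrDr scalerDl.
Qed.
Fact mu0_mulZl a (x y : mu0) : mu0_mul (a *: x) y = a *: mu0_mul x y.
Proof.
rewrite /mu0_mul scaler_sumr; apply: eq_bigr => i _.
rewrite scaler_sumr; apply: eq_bigr => j _.
by rewrite mxE scalerA mulrA.
Qed.
Fact mu0_mulZr a (x y : mu0) : mu0_mul x (a *: y) = a *: mu0_mul x y.
Proof.
rewrite /mu0_mul scaler_sumr; apply: eq_bigr => i _.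
rewrite scaler_sumr; apply: eq_bigr => j _.
by rewrite mxE scalerA mulrCA.
Qed.

Lemma mu0_e_out k : (m < k)%N -> mu0_e k = 0.
Proof.
move=> lt_mk; apply/rowP => i; rewrite !mxE.
by rewrite ltn_eqF // (leq_ltn_trans _ lt_mk).
Qed.

Fact mu0_mul0l y : mu0_mul 0 y = 0.
Proof. by have := mu0_mulZl 0 0 y; rewrite !scale0r. Qed.
Fact mu0_mul0r x : mu0_mul x 0 = 0.
Proof. by have := mu0_mulZr 0 x 0; rewrite !scale0r. Qed.

Lemma mu0_mul_e i j : (1 <= i)%N -> (1 <= j)%N ->
  mu0_mul (mu0_e i) (mu0_e j) = mu0_e (i + j).
Proof.
case: i j => [//|i] [//|j] _ _.
have [le_mi|lt_im] := leqP m i.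
  rewrite [mu0_e i.+1]mu0_e_out // mu0_mul0l mu0_e_out //.
  by rewrite ltnS (leq_trans le_mi) ?leq_addr.
have [le_mj|lt_jm] := leqP m j.
  rewrite [mu0_e j.+1]mu0_e_out // mu0_mul0r mu0_e_out //.
  by rewrite addnS ltnS (leq_trans le_mj) ?leq_addl.
rewrite /mu0_mul (bigD1 (Ordinal lt_im)) //= [X in _ + X]big1 => [|a ne_ai].
  rewrite addr0 (bigD1 (Ordinal lt_jm)) //= [X in _ + X]big1 => [|b ne_bj].
    by rewrite addr0 !mxE !eqxx mulr1 scale1r.
  by rewrite !mxE [b.+1 == _](negbTE ne_bj) mulr0 scale0r.
by apply: big1 => b _; rewrite !mxE [a.+1 == _](negbTE ne_ai) mul0r scale0r.
Qed.

Fact mu0_mulA : associative mu0_mul.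
Proof.
have suml n (f : 'I_n -> mu0) y :
    mu0_mul (\sum_(i < n) f i) y = \sum_(i < n) mu0_mul (f i) y.
  by apply: (big_morph (mu0_mul^~ y)) => [u v|]; rewrite ?mu0_mulDl ?mu0_mul0l.
have sumr n (f : 'I_n -> mu0) x :
    mu0_mul x (\sum_(i < n) f i) = \sum_(i < n) mu0_mul x (f i).
  by apply: (big_morph (mu0_mul x)) => [u v|]; rewrite ?mu0_mulDr ?mu0_mul0r.
move=> x y z; rewrite [x]mu0_sum_e; set f := BIG_F.
rewrite (suml _ f y) (suml _ f) (suml _ (fun i => mu0_mul (f i) y)).
apply: eq_bigr => i _; rewrite /f !mu0_mulZl; congr (_ *: _).
rewrite [y]mu0_sum_e; set g := BIG_F.
rewrite (sumr _ g) (suml _ g) (sumr _ (fun j => mu0_mul (g j) z)).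
rewrite (suml _ (fun j => mu0_mul _ (g j))).
apply: eq_bigr => j _; rewrite /g !(mu0_mulZl, mu0_mulZr); congr (_ *: _).
rewrite [z]mu0_sum_e; set h := BIG_F.
rewrite (sumr _ h (mu0_e _)) (sumr _ h) (sumr _ (fun k => mu0_mul _ (h k))).
apply: eq_bigr => k _; rewrite /h !mu0_mulZr.
by rewrite !mu0_mul_e ?addn_gt0 // addnA.
Qed.

HB.instance Definition _ := Lmodule_isNuAlg.Build F mu0
  mu0_mulA mu0_mulDl mu0_mulDr mu0_mulZl mu0_mulZr.

Lemma numul_mu0_e i j : (1 <= i)%N -> (1 <= j)%N -> mu0_e i ** mu0_e j = mu0_e (i + j).
Proof. exact: mu0_mul_e. Qed.

End TruncatedPolynomial.

Section ZeroMultiplication.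

Variable p : nat.

Definition zeroalg : Type := 'rV[F]_p.
HB.instance Definition _ := Vector.on zeroalg.

Definition zeroalg_mul (x y : zeroalg) : zeroalg := 0.

Fact zeroalg_mulA : associative zeroalg_mul. Proof. by []. Qed.
Fact zeroalg_mulDl : left_distributive zeroalg_mul +%R.
Proof. by move=> x y z; rewrite /zeroalg_mul addr0. Qed.
Fact zeroalg_mulDr : right_distributive zeroalg_mul +%R.
Proof. by move=> x y z; rewrite /zeroalg_mul addr0. Qed.
Fact zeroalg_mulZl a (x y : zeroalg) :
  zeroalg_mul (a *: x) y = a *: zeroalg_mul x y.
Proof. by rewrite /zeroalg_mul scaler0. Qed.
Fact zeroalg_mulZr a (x y : zeroalg) :
  zeroalg_mul x (a *: y) = a *: zeroalg_mul x y.
Proof. by rewrite /zeroalg_mul scaler0. Qed.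

HB.instance Definition _ := Lmodule_isNuAlg.Build F zeroalg
  zeroalg_mulA zeroalg_mulDl zeroalg_mulDr zeroalg_mulZl zeroalg_mulZr.

End ZeroMultiplication.

Section DirectSum.

Variables A B : nuAlgType F.

Definition pair_numul (x y : A * B) : A * B := (x.1 ** y.1, x.2 ** y.2).

Fact pair_numulA : associative pair_numul.
Proof. by move=> x y z; rewrite /pair_numul !numulA. Qed.
Fact pair_numulDl : left_distributive pair_numul +%R.
Proof. by move=> x y z; rewrite /pair_numul !numulDl. Qed.
Fact pair_numulDr : right_distributive pair_numul +%R.
Proof. by move=> x y z; rewrite /pair_numul !numulDr. Qed.
Fact pair_numulZl a x y : pair_numul (a *: x) y = a *: pair_numul x y.
Proof. by rewrite /pair_numul !numulZl. Qed.
Fact pair_numulZr a x y : pair_numul x (a *: y) = a *: pair_numul x y.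
Proof. by rewrite /pair_numul !numulZr. Qed.

HB.instance Definition _ := Lmodule_isNuAlg.Build F (A * B)%type
  pair_numulA pair_numulDl pair_numulDr pair_numulZl pair_numulZr.

End DirectSum.
End Models.


HB.instance Definition _ (F : fieldType) (A B : nuVectAlgType F) :=
  NuAlg.on (A * B)%type.

(* Main.v *)
From HB Require Import structures.
Require Import Defs.
From mathcomp Require Import all_boot all_order all_algebra.
From mathcomp Require Import zify.

(** By associativity the product A/A^2 x A/A^2 -> A^2/A^3 has rank one and is a
    multiple of phi(x) phi(y) for some linear form phi. If phi(e) <> 0, the powers
    of e span A^i/A^(i+1) for i >= 2, while ker phi is annihilated by A modulo A^3. Hence
    in gr A the class of e generates a copy of mu_0^(n-p), and a complement of A^2
    in ker phi supplies the null factor F^p. *)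

Set Implicit Arguments.
Unset Strict Implicit.
Unset Printing Implicit Defensive.

Import GRing.Theory.
Local Open Scope ring_scope.

(** * Hyperplanes, and recognition of the model algebra *)

Lemma dimv_basis_tuple (F : fieldType) (V : vectType F) (U : {vspace V}) d :
  \dim U = d -> exists c : d.-tuple V, basis_of U c.
Proof. by move=> <-; exists (vbasis U); apply: vbasisP. Qed.

(** [g] spans the line [U :\: W] and [l] is the coordinate of the projection onto it along [W]. This
    turns a one-dimensional quotient A^i/A^(i+1) into scalars, with [l] defined on the whole space
    so that it applies to any product. *)
Lemma subv_codim1 (F : fieldType) (V : vectType F) (U W : {vspace V}) :
  (W <= U)%VS -> \dim U = (\dim W).+1 ->
  exists (g : V) (l : {linear V -> F^o}),
    [/\ g \in U, {in W, forall x, l x = 0} & {in U, forall x, x - l x *: g \in W}].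
Proof.
move=> sWU dimU.
have /dimv_basis_tuple[c c_basis] : \dim (U :\: W) = 1%N.
  by have := dimv_cap_compl U W; rewrite (capv_idPr sWU) dimU -addn1 => /addnI.
pose l : {linear V -> F^o} := coord c ord0 \o daddv_pi (U :\: W) W.
have disj : ((U :\: W) :&: W = 0)%VS by exact: capv_diff.
have pi_g x : daddv_pi (U :\: W) W x = l x *: c`_0.
  rewrite {1}(coord_basis c_basis (memv_pi _ _ x)); exact: big_ord1.
exists c`_0, l; split.
- apply: (subvP (diffvSl U W)); apply: (basis_mem c_basis).
  by rewrite mem_nth // size_tuple.
- move=> x Wx; rewrite /l /= [daddv_pi _ _ _](_ : _ = 0) ?linear0 //.
  have := daddv_pi_add disj (subvP (addvSr _ _) _ Wx).
  have := daddv_pi_id (etrans (capvC _ _) disj) Wx => -> /eqP.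
  by rewrite -subr_eq0 addrK => /eqP.
- move=> x Ux; rewrite -pi_g.
  have Sx : x \in (U :\: W + W)%VS by rewrite addv_diff (subvP (addvSl _ _)).
  by rewrite -{1}(daddv_pi_add disj Sx) addrC addKr memv_pi.
Qed.

Lemma nuprodv_notsub (F : fieldType) (A : nuVectAlgType F) (U V W : {vspace A}) :
  ~~ (nuprodv U V <= W)%VS ->
  exists u v, [/\ u \in U, v \in V & u ** v \notin W].
Proof.
move=> nsub; set s := [seq u ** v | u <- vbasis U, v <- vbasis V].
have /allPn[_ /allpairsP[[u v] /= [Uu Vv ->]] nW] : ~~ all [in W] s.
  by apply: contra nsub => /allP sW; apply/span_subvP.
by exists u, v; split; [exact: vbasis_mem Uu | exact: vbasis_mem Vv | exact: nW].
Qed.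

(** Here [u i] plays e_(i+1), whence the shift in [u (i + j).+1]. The linear map sending the model
    basis to [u] and [v] is multiplicative, injective by independence and surjective by dimension;
    its inverse is the isomorphism. *)
Lemma mu0_zeroalg_iso (F : fieldType) (A : nuVectAlgType F) m p
    (u : nat -> A) (v : 'I_p -> A) :
  \dim {:A} = (m + p)%N ->
  (forall i j, u i ** u j = u (i + j).+1) ->
  (forall i, (m <= i)%N -> u i = 0) ->
  (forall i j, u i ** v j = 0) -> (forall i j, v j ** u i = 0) ->
  (forall i j, v i ** v j = 0) ->
  (forall (x : 'I_m -> F) (y : 'I_p -> F),
     \sum_i x i *: u i + \sum_j y j *: v j = 0 -> x =1 (fun=> 0) /\ y =1 (fun=> 0)) ->
  nualg_isomorphic A (mu0 F m * zeroalg F p)%type.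
Proof.
move=> dimA uu u0 uv vu vv indep.
pose h1 (x : mu0 F m) : A := \sum_(i < m) (x : 'rV_m) 0 i *: u i.
pose h2 (y : zeroalg F p) : A := \sum_(j < p) (y : 'rV_p) 0 j *: v j.
have h1_lin : linear h1.
  move=> a s t; rewrite /h1 scaler_sumr -big_split /=.
  by apply: eq_bigr => i _; rewrite !mxE scalerDl scalerA.
have h2_lin : linear h2.
  move=> a s t; rewrite /h2 scaler_sumr -big_split /=.
  by apply: eq_bigr => i _; rewrite !mxE scalerDl scalerA.
pose l1 : {linear mu0 F m -> A} := HB.pack h1 (GRing.isLinear.Build _ _ _ _ h1 h1_lin).
pose l2 : {linear zeroalg F p -> A} :=
  HB.pack h2 (GRing.isLinear.Build _ _ _ _ h2 h2_lin).
pose h0 (t : mu0 F m * zeroalg F p) : A := l1 t.1 + l2 t.2.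
have h0_lin : linear h0 by move=> a s t; rewrite /h0 !linearP /= scalerDr addrACA.
pose hl : {linear _ -> _} := HB.pack h0 (GRing.isLinear.Build _ _ _ _ h0 h0_lin).
pose h := linfun hl.
have hE t : h t = h0 t by rewrite lfunE.
have ker0 : lker h == 0%VS.
  rewrite -subv0; apply/subvP => -[x y]; rewrite memv_ker hE memv0 /h0 /=.
  move=> /eqP /indep[x0 y0]; apply/eqP; congr (_, _); apply/rowP => i.
  - by rewrite x0 mxE.
  - by rewrite y0 mxE.
have full : limg h = fullv.
  apply/eqP; rewrite eqEdim subvf (limg_dim_eq (U := fullv)); last first.
    by rewrite (eqP ker0) capv0.
  by rewrite dimA dimvf -[dim _]/(1 * m + 1 * p)%N; lia.
have hK : cancel h (h^-1)%VF := lker0_lfunK ker0.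
have hVK : cancel (h^-1)%VF h.
  by move=> x; apply: limg_lfunVK; rewrite full memvf.
have h_mul s t : h (s ** t) = h s ** h t.
  rewrite !hE.
  (* Holds for every [k]: both sides vanish once [m <= k], so products that leave the range need no
     separate case. *)
  have l1_e k : l1 (mu0_e F m k.+1) = u k.
    rewrite /= /h1; have [lt_km|le_mk] := ltnP k m.
      rewrite (bigD1 (Ordinal lt_km)) //= big1 => [|i ne_i].
        by rewrite !mxE eqxx scale1r addr0.
      by rewrite !mxE eqSS [_ == k](negbTE ne_i) scale0r.
    rewrite u0 // big1 // => i _; rewrite !mxE eqSS ltn_eqF ?scale0r //.
    exact: leq_trans le_mk.
  have l1_mul x y : l1 (x ** y) = l1 x ** l1 y.
    rewrite [x ** y]/(mu0_mul x y) /mu0_mul linear_sum numul_suml.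
    apply: eq_bigr => i _; rewrite linear_sum numul_sumr.
    apply: eq_bigr => j _; rewrite linearZ -[(_ + _)%N]/(i + j.+1).+1 l1_e addnS.
    by rewrite -uu numulZl numulZr scalerA.
  have z12 x y : l1 x ** l2 y = 0.
    rewrite numul_suml big1 // => i _; rewrite numul_sumr big1 // => j _.
    by rewrite numulZl numulZr uv !scaler0.
  have z21 x y : l2 y ** l1 x = 0.
    rewrite numul_suml big1 // => i _; rewrite numul_sumr big1 // => j _.
    by rewrite numulZl numulZr vu !scaler0.
  have z22 x y : l2 x ** l2 y = 0.
    rewrite numul_suml big1 // => i _; rewrite numul_sumr big1 // => j _.
    by rewrite numulZl numulZr vv !scaler0.
  rewrite /h0 numulDl !numulDr z12 z21 z22 addr0 add0r addr0.
  have -> : s ** t = (s.1 ** t.1, 0) by [].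
  by rewrite linear0 addr0 l1_mul.
exists (h^-1)%VF; split; first by exists h.
by move=> x y; apply: (can_inj hK); rewrite h_mul !hVK.
Qed.

(** * Homogeneous elements of gr A *)

Section GradedEmbedding.

Variables (F : fieldType) (A : nuVectAlgType F).

(** The degree is [i.+1], matching the 0-based components of [gr]; the value is 0 when [i] is at
    least dim A. It represents [x] faithfully only for [x] in A^(i+1). *)
Definition gr_in (i : nat) (x : A) : gr A :=
  [ffun k : 'I_(\dim {:A}) => if (k : nat) == i then grcls k.+1 x else 0].

(** Turns a relation modulo the next power of A into an exact one in gr A. *)
Lemma gr_in_eq0 i x : x \in nupow A i.+2 -> gr_in i x = 0.
Proof.
move=> Ux; apply/ffunP => k; rewrite !ffunE; case: eqP Ux => // <- Ux.
rewrite -(raddf0 (grcls (A := A) k.+1)); apply/grcls_eq; rewrite ?mem0v ?subr0 //.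
exact: (subvP (nupow_anti _ _)).
Qed.

Lemma gr_in_mul i j x y : x \in nupow A i.+1 -> y \in nupow A j.+1 ->
  gr_in i x ** gr_in j y = gr_in (i + j).+1 (x ** y).
Proof.
move=> Ux Uy; apply/ffunP => k; rewrite !ffunE.
case: eqP => [kij | nkij].
  have lt_i : (i < \dim {:A})%N by have := ltn_ord k; lia.
  have lt_j : (j < \dim {:A})%N by have := ltn_ord k; lia.
  rewrite (bigD1 (Ordinal lt_i)) //= [X in _ + X]big1 ?addr0 => [|i' ne_i].
    rewrite (big_pred1 (Ordinal lt_j)) => [|j'].
      by rewrite !ffunE /= !eqxx grmul_cls // kij; lia.
    by rewrite /= -val_eqE /= kij; lia.
  rewrite big1 // => j' /eqP kE; rewrite ffunE -val_eqE /= in ne_i *.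
  by rewrite (negbTE ne_i) grmul0l.
rewrite big1 // => i' _; rewrite big1 // => j' /eqP kE; rewrite !ffunE.
case: eqP => [ii|]; last by rewrite grmul0l.
case: eqP => [jj|]; last by rewrite grmul0r.
by case: nkij; lia.
Qed.

Lemma gr_sumE I r (P : pred I) (f : I -> gr A) k :
  (\sum_(i <- r | P i) f i) k = \sum_(i <- r | P i) f i k.
Proof. by apply: (big_morph (fun t : gr A => t k)) => [s t|]; rewrite ffunE. Qed.

End GradedEmbedding.

(** * The linear form phi and the powers of e *)

Section Filiform.

Variables (F : fieldType) (A : nuVectAlgType F).
Local Notation "A ^[ i ]" := (nupow A i) (at level 2, format "A ^[ i ]").

Lemma dim_nupowS p i : (p + 2 < \dim {:A})%N -> filiform A p ->
  (2 <= i <= \dim {:A} - p)%N -> \dim A^[i] = (\dim A^[i.+1]).+1.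
Proof. by move=> lt_p fil i_bd; rewrite !fil; lia. Qed.

(* Write xy = b(xy) g mod A^3, with g and g3 spanning A^2/A^3 and A^3/A^4, and
   x g = phi(x) g3, g z = psi(z) g3 mod A^4. Associativity of x y z then reads
   phi(x) b(yz) = b(xy) psi(z), so b(xy) is proportional to phi(x) phi(y). *)
Lemma annihilating_hyperplane :
  (forall i, (2 <= i <= 3)%N -> \dim A^[i] = (\dim A^[i.+1]).+1) ->
  exists phi : {linear A -> F^o},
    [/\ exists e, phi e != 0, {in A^[2], forall x, phi x = 0} &
        forall k x, phi k = 0 -> k ** x \in A^[3] /\ x ** k \in A^[3]].
Proof.
move=> dimS.
have [g [b [Ug _ bP]]] := subv_codim1 (nupow_anti A 2) (dimS 2 isT).
have [g3 [c [_ c0 cP]]] := subv_codim1 (nupow_anti A 3) (dimS 3 isT).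
have mul2 x y : x ** y \in A^[2] by rewrite (@nupow_mul _ _ 1 1) ?memvf.
have bmem x y : b (x ** y) = 0 -> x ** y \in A^[3].
  by move=> b_xy; have := bP _ (mul2 x y); rewrite b_xy scale0r subr0.
have phi_lin : linear (fun x => c (x ** g) : F^o).
  by move=> a x y; rewrite numulDl numulZl linearP.
pose phi : {linear A -> F^o} := HB.pack (fun x => c (x ** g) : F^o)
  (GRing.isLinear.Build _ _ _ _ (fun x => c (x ** g) : F^o) phi_lin).
pose psi z := c (g ** z).
have dec w : w \in A^[2] -> exists2 d, d \in A^[3] & w = d + b w *: g.
  by move=> /bP; exists (w - b w *: g); rewrite ?subrK.
have cl x w : w \in A^[2] -> c (x ** w) = b w * phi x.
  move=> /dec[d Ud {1}->]; rewrite numulDr linearD numulZr linearZ.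
  by rewrite [c (x ** d)]c0 ?add0r // (@nupow_mul _ _ 1 3) ?memvf.
have cr w z : w \in A^[2] -> c (w ** z) = b w * psi z.
  move=> /dec[d Ud {1}->]; rewrite numulDl linearD numulZl linearZ.
  by rewrite [c (d ** z)]c0 ?add0r // (@nupow_mul _ _ 3 1) ?memvf.
have assoc x y z : b (y ** z) * phi x = b (x ** y) * psi z.
  by rewrite -cl // -cr // numulA.
have not_sub i : (2 <= i <= 3)%N -> ~~ (A^[i] <= A^[i.+1])%VS.
  by move=> /dimS dimi; apply/negP => /dimvS; rewrite dimi ltnn.
(* Since A^3 = A A^2 is not contained in A^4, some [x ** w] with [w] in A^2 lies outside A^4; [cl]
   then excludes [phi x = 0]. *)
have [x0 phi0] : exists x0, phi x0 != 0.
  have := not_sub 3 isT; rewrite (@nupowSl _ _ 2) // => /nuprodv_notsub[x [w [_ Uw]]].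
  move=> nxw; exists x; apply: contraNneq nxw => phix.
  have : x ** w \in A^[3] by rewrite (@nupow_mul _ _ 1 2) ?memvf.
  by move=> /cP; rewrite cl // phix mulr0 scale0r subr0.
have [y0 [z0 b_yz]] : exists y z, b (y ** z) != 0.
  have := not_sub 2 isT; rewrite (@nupowSl _ _ 1) // => /nuprodv_notsub[y [z [_ _]]].
  by move=> nyz; exists y, z; apply: contraNneq nyz => /bmem.
(* The left side of [assoc x0 y0 z0] is nonzero. Below, [psi z0] is cancelled from [assoc] twice:
   first with [k] in the left position, then in the middle. *)
have psi0 : psi z0 != 0.
  have : b (y0 ** z0) * phi x0 != 0 by rewrite mulf_neq0.
  by rewrite assoc mulf_eq0 negb_or => /andP[].
exists phi; split; first by exists x0.
  by move=> x Ux; apply: c0; rewrite (@nupow_mul _ _ 2 2).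
move=> k x phik.
have bk y : b (k ** y) = 0.
  apply/eqP; have := assoc k y z0; rewrite phik mulr0 => /esym/eqP.
  by rewrite mulf_eq0 (negbTE psi0) orbF.
split; apply: bmem => //.
apply/eqP; have := assoc x k z0; rewrite bk mul0r => /esym/eqP.
by rewrite mulf_eq0 (negbTE psi0) orbF.
Qed.

Lemma nupow_le i j : (i <= j)%N -> (A^[j] <= A^[i])%VS.
Proof.
move=> /subnK <-; elim: (j - i)%N => // d; exact/subv_trans/nupow_anti.
Qed.

(** Without a unit the exponent is shifted: this is e^(i+1), which lies in A^(i+1). *)
Definition nuexp (e : A) i := iter i (numul e) e.

Lemma nuexpD e i j : nuexp e i ** nuexp e j = nuexp e (i + j).+1.
Proof. by elim: i => //= i IHi; rewrite -numulA IHi. Qed.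

Lemma nuexp_mem e i : nuexp e i \in A^[i.+1].
Proof.
elim: i => [|i IHi]; first by rewrite memvf.
by rewrite (@nupow_mul _ _ 1 i.+1) ?memvf.
Qed.

(** A is spanned by [e] and ker phi, and products with ker phi fall into A^3. Hence e^(i+2) spans
    A^(i+2) modulo A^(i+3), and it cannot lie in A^(i+3) because the dimension drops there. *)
Lemma nuexp_notin m (phi : {linear A -> F^o}) e :
  (forall i, (2 <= i <= m)%N -> \dim A^[i] = (\dim A^[i.+1]).+1) ->
  phi e != 0 -> {in A^[2], forall x, phi x = 0} ->
  (forall k x, phi k = 0 -> k ** x \in A^[3] /\ x ** k \in A^[3]) ->
  forall i, (i < m)%N -> nuexp e i \notin A^[i.+2].
Proof.
move=> dimS phie phi2 phik.
have split_e x : exists a k, phi k = 0 /\ x = a *: e + k.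
  exists (phi x / phi e), (x - (phi x / phi e) *: e).
  split; last by rewrite addrC subrK.
  rewrite linearB linearZ /=.
  by rewrite -[_ *: _]/(_ * _) divfK // subrr.
have gen i : (A^[i.+2] <= <[nuexp e i.+1]> + A^[i.+3])%VS.
  elim: i => [|i IHi]; rewrite nupowSl //; apply/nuprodvP => x y _.
    move=> _; have [a [k [k0 ->]]] := split_e x.
    have [b [l [l0 ->]]] := split_e y.
    rewrite numulDl numulDr -addrA memv_add //.
      by rewrite numulZl numulZr !memvZ ?memv_line.
    rewrite memvD // ?(phik _ _ k0).1 //.
    by rewrite numulZl memvZ // (phik _ _ l0).2.
  move=> /(subvP IHi)/memv_addP[_ /vlineP[b ->] [w Uw ->]].
  have [a [k [k0 ->]]] := split_e x.
  rewrite numulDr numulDl -addrA memv_add //.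
    by rewrite numulZl numulZr !memvZ ?memv_line.
  rewrite memvD //; last by rewrite (@nupow_mul _ _ 1 i.+3) ?memvf.
  (* For [k] in ker phi, k e^(i+2) = (k e) e^(i+1) gains one degree from k e in A^3. *)
  rewrite numulZr memvZ //= numulA.
  by rewrite (@nupow_mul _ _ 3 i.+1) ?nuexp_mem ?(phik _ _ k0).1.
(* For [i = 0] the claim is that [e] lies outside A^2, where phi vanishes. *)
case=> [|i] lt_im; first by apply: contra phie => /phi2 ->.
apply/negP => Ue.
have /dimvS : (A^[i.+2] <= A^[i.+3])%VS.
  by apply: subv_trans (gen i) _; rewrite subv_add subvv andbT -memvE.
by rewrite dimS ?ltnn.
Qed.

(** As [f] is injective, a relation can be read in gr A degree by degree. Each degree from 2 to [m]
    contains a single power of [e], nonzero there; degree 1 contains [e] and all [k j], which are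
    independent modulo A^2. *)
Lemma graded_independent m p (f : {linear gr A -> A}) (e : A) (k : 'I_p -> A) :
  bijective f -> (0 < m <= \dim {:A})%N ->
  (forall i, (i < m)%N -> nuexp e i \notin A^[i.+2]) ->
  (forall a (y : 'I_p -> F), a *: e + \sum_j y j *: k j \in A^[2] ->
     a = 0 /\ y =1 (fun=> 0)) ->
  forall (x : 'I_m -> F) (y : 'I_p -> F),
    \sum_i x i *: f (gr_in i (nuexp e i)) + \sum_j y j *: f (gr_in 0 (k j)) = 0 ->
    x =1 (fun=> 0) /\ y =1 (fun=> 0).
Proof.
move=> /bij_inj f_inj /andP[m_gt0 le_m] e_notin indep x y.
under eq_bigr => i _ do rewrite -linearZ.
under [X in _ + X]eq_bigr => j _ do rewrite -linearZ.
rewrite -!linear_sum -linearD -(linear0 f) => /f_inj sum0.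
have at_deg (l : 'I_(\dim {:A})) :
    \sum_(i < m) (if l == i :> nat then x i *: grcls l.+1 (nuexp e i) else 0)
    + \sum_(j < p) (if l == 0%N :> nat then y j *: grcls l.+1 (k j) else 0) = 0.
  have := congr1 (fun t : gr A => t l) sum0; rewrite !ffunE !gr_sumE => E.
  rewrite -[RHS]E {E}.
  by congr (_ + _); apply: eq_bigr => i _; rewrite !ffunE; case: eqP; rewrite ?scaler0.
have xP (i : 'I_m) : (0 < i)%N -> x i = 0.
  move=> i_gt0; have := at_deg (widen_ord le_m i).
  rewrite (bigD1 i) //= eqxx (gtn_eqF i_gt0) big1 ?addr0 => [|j ne_j]; last first.
    by rewrite eq_sym [LHS in if LHS then _ else _](negbTE ne_j).
  rewrite big1 ?addr0 // -grclsZ ?nuexp_mem // => cls0; apply/eqP.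
  apply: contraNT (e_notin i (ltn_ord i)) => xi.
  suff : x i *: nuexp e i \in A^[i.+2].
    by rewrite -{2}[nuexp e i]scale1r -(mulVf xi) -scalerA; apply: memvZ.
  rewrite -[_ *: _]subr0; apply/grcls_eq; rewrite ?mem0v ?memvZ ?nuexp_mem //.
  by rewrite raddf0.
have := at_deg (widen_ord le_m (Ordinal m_gt0)).
rewrite (bigD1 (Ordinal m_gt0)) //= big1 ?addr0 => [|i ne_i]; last first.
  by rewrite xP ?scale0r ?if_same // lt0n.
under eq_bigr => j _ do rewrite -grclsZ ?memvf //.
rewrite -grclsZ ?memvf // -raddf_sum -raddfD => cls0.
have /indep[x0 y0] : x (Ordinal m_gt0) *: e + \sum_j y j *: k j \in A^[2].
  by rewrite -[_ + _]subr0; apply/grcls_eq; rewrite ?memvf // raddf0.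
split=> // i; have [i0|/xP //] := posnP i.
by rewrite -[RHS]x0; congr x; apply: val_inj.
Qed.

End Filiform.

(** * A model basis built in gr A and carried to A by the natural grading *)

Theorem theorem3p2 (F : fieldType) (charF : [pchar F] =i pred0) (p n : nat)
    (hp : (1 <= p)%N) (hn : (p + 2 < n)%N) (A : nuVectAlgType F)
    (dimA : \dim {:A} = n) (gradedA : naturally_graded A)
    (filiformA : filiform A p) :
  nualg_isomorphic A (mu0 F (n - p) * zeroalg F p)%type.
Proof.
have [_ [f [f_bij f_mul]]] := gradedA.
have dimS i : (2 <= i <= n - p)%N -> \dim (nupow A i) = (\dim (nupow A i.+1)).+1.
  by move=> i_bd; apply: (dim_nupowS (p := p)); rewrite ?dimA.
have [|phi [[e phie] phi2 phik]] := @annihilating_hyperplane _ A.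
  by move=> i i_bd; apply: dimS; lia.
have e_notin := nuexp_notin dimS phie phi2 phik.
(* A^2 has dimension n-p-1 and meets the line of [e] trivially since phi separates them, so the
   complement has dimension p. *)
have [c c_basis] : exists c : p.-tuple A, basis_of (nupow A 2 + <[e]>)^C c.
  apply: dimv_basis_tuple; rewrite dimv_compl dimv_disjoint_sum.
    have e0 : e != 0 by apply: contraNneq phie => ->; rewrite linear0.
    by rewrite dim_vline e0 filiformA dimA; lia.
  apply/eqP; rewrite -subv0; apply/subvP => x; rewrite memv_cap memv0.
  case/andP => Ux /vlineP[a xE]; move: (phi2 _ Ux) => /eqP.
  by rewrite xE linearZ /= mulf_eq0 (negbTE phie) orbF => /eqP ->; rewrite scale0r.
(* Correcting by a multiple of [e] moves each [c_j] into ker phi. *)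
pose k (j : 'I_p) := c`_j - (phi c`_j / phi e) *: e.
have phi_k j : phi (k j) = 0.
  by rewrite linearB linearZ /= -[_ *: _]/(_ * _) divfK // subrr.
have mem1 x : x \in nupow A 1 by exact: memvf.
apply: (@mu0_zeroalg_iso _ _ _ _ (fun i => f (gr_in i (nuexp e i)))
  (fun j => f (gr_in 0 (k j)))).
- by rewrite dimA; lia.
- by move=> i j; rewrite -f_mul gr_in_mul ?nuexp_mem // nuexpD.
- move=> i le_i; rewrite gr_in_eq0 ?linear0 //.
  (* The filiform condition at its last index n-p+1 gives dimension 0. *)
  have Amp0 : nupow A (n - p).+1 = 0%VS.
    by apply/eqP; rewrite -dimv_eq0 filiformA dimA; lia.
  have := subvP (nupow_le A (leq_ltn_trans le_i (ltnSn i))) _ (nuexp_mem e i).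
  by rewrite Amp0 memv0 => /eqP ->; rewrite mem0v.
(* In gr A this product sits in degree i+2, but for i > 0 one has e^(i+1) k = e^i (e k) with e k in
   A^3, so it lies in A^(i+3) and its class is zero. The mirror product is treated alike. *)
- move=> i j; rewrite -f_mul gr_in_mul ?nuexp_mem // addn0 gr_in_eq0 ?linear0 //.
  case: i => [|i]; first exact: (phik _ _ (phi_k j)).2.
  rewrite -[i in nuexp e i.+1]addn0 -nuexpD -numulA -[i.+4]/(i.+1.+3) -addn3.
  by rewrite nupow_mul ?nuexp_mem // (phik _ _ (phi_k j)).2.
- move=> i j; rewrite -f_mul gr_in_mul ?nuexp_mem // add0n gr_in_eq0 ?linear0 //.
  case: i => [|i]; first exact: (phik _ _ (phi_k j)).1.
  rewrite /= numulA (@nupow_mul _ _ 3 i.+1) ?nuexp_mem //.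
  exact: (phik _ _ (phi_k j)).1.
- move=> i j; rewrite -f_mul gr_in_mul // gr_in_eq0 ?linear0 //.
  exact: (phik _ _ (phi_k i)).1.
- apply: graded_independent e_notin _ => //; first by rewrite dimA; lia.
  move=> a y Uay.
  have phi_sum : phi (\sum_j y j *: k j) = 0.
    by rewrite linear_sum big1 // => j _; rewrite linearZ /= phi_k scaler0.
  have a0 : a = 0.
    move/eqP: (phi2 _ Uay); rewrite linearD phi_sum addr0 linearZ /= mulf_eq0.
    by rewrite (negbTE phie) orbF => /eqP.
  have free_c := elimT freeP (basis_free c_basis).
  (* The sum of the [y j *: c_j] differs from that of the [y j *: k j] by a multiple of [e], so it
     lies both in A^2 + <e> and in the complement spanned by the [c_j]. *)
  split=> // j; move: j; apply: free_c.
  apply/eqP; rewrite -memv0 -(capv_compl (nupow A 2 + <[e]>)) memv_cap.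
  rewrite andbC memv_suml => [|j _]; last first.
    by rewrite memvZ // (basis_mem c_basis) // mem_nth ?size_tuple.
  have -> : \sum_j y j *: c`_j =
      \sum_j y j *: k j + (\sum_j y j * (phi c`_j / phi e)) *: e.
    rewrite scaler_suml -big_split; apply: eq_bigr => j _ /=.
    by rewrite -scalerA -scalerDr subrK.
  rewrite memv_add ?memvZ ?memv_line //.
  by move: Uay; rewrite a0 scale0r add0r.
Qed.
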